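(* Let $G_n$ be a sequence of graphs such that $G_n$ has $2n$ vertices and minimum degree $2n-o(n)$, and let $M_n\subseteq G_n$ be a sequence of perfect matchings. Let $R_n$ be a uniformly random perfect matching of $G_n$ and let $X$ be the number of edges shared by $M_n$ and $R_n$. Then \[\mathrm{d}_{\mathrm{TV}}\left(X,\mathrm{Po}\left(\tfrac12\right)\right)\to 0\] as $n\to\infty$.
   Context: For integer-valued random variables $X,Y$, $\mathrm{d}_{\mathrm{TV}}(X,Y)=\frac12\sum_{k\in\mathbb{Z}}|\Pr(X=k)-\Pr(Y=k)|$. $\mathrm{Po}(\lambda)$ denotes a Poisson random variable with parameter $\lambda$. Minimum degree $2n-o(n)$ means the minimum degree is $2n-t_n$ with $t_n/n\to 0$. *)

(* Defs.v *)
From HB Require Import structures.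
From mathcomp Require Import all_boot all_order all_algebra.
From mathcomp Require Import all_classical all_reals all_analysis.

Set Implicit Arguments.
Unset Strict Implicit.
Unset Printing Implicit Defensive.

Import Order.TTheory GRing.Theory Num.Theory.
Import numFieldNormedType.Exports.

Record simple_graph (T : finType) := SimpleGraph {
  adj :> rel T;
  adj_sym : symmetric adj;
  adj_irrefl : irreflexive adj
}.

Section Graphs.
Local Open Scope nat_scope.
Context (T : finType) (G : simple_graph T).

Definition degree (x : T) : nat := #|[pred y | G x y]|.

(* Every degree is less than #|T|, so the default value of the iterated minimum
   is attained only for the graph without vertices. *)
Definition min_degree : nat := \big[minn/#|T|]_(x : T) degree x.

Definition edges : {set {set T}} :=
  finset (fun A : {set T} =>
    [exists x : T, exists y : T, G x y && (A == [set x; y]%SET)]).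

Definition perfect_matching (M : {set {set T}}) : bool :=
  [&& M \subset edges, finset.trivIset M & finset.cover M == [set: T]%SET].

End Graphs.

Section Probability.
Local Open Scope classical_set_scope.
Local Open Scope ring_scope.

(* X is a random element of the finite type F, with uniform law on the elements
   satisfying A. For finite F, measurability of X amounts to that of its
   fibres. *)
Definition uniformly_distributed (R : realType) (d : measure_display)
    (Omega : measurableType d) (P : probability Omega R)
    (F : finType) (A : pred F) (X : Omega -> F) : Prop :=
  forall a : F, measurable (X @^-1` [set a]) /\
    P (X @^-1` [set a]) = (if A a then (#|A|%:R)^-1 else 0)%:E.

Definition dTV (R : realType)
    (d1 : measure_display) (Omega1 : measurableType d1)
    (P1 : probability Omega1 R) (X : Omega1 -> int)
    (d2 : measure_display) (Omega2 : measurableType d2)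
    (P2 : probability Omega2 R) (Y : Omega2 -> int) : \bar R :=
  ((2^-1)%:E * \esum_(k in [set: int])
     `| P1 (X @^-1` [set k]) - P2 (Y @^-1` [set k]) |)%E.

End Probability.

(* The last argument of [poisson_prob] is unused by the library. *)
Notation Po lambda := (poisson_prob lambda 0%N).

(* Main.v *)
(* Encode a perfect matching as an involution f with x ~ f x, and switch it at u
   towards a: the edges {u, f u} and {a, f a} become {u, a} and {f u, f a}, which
   is conjugation by the transposition (f u, a). Let t = o(n) bound the number of
   non-neighbours of a vertex, M be the fixed matching, R the random one, and p_k
   the probability that R shares exactly k edges with M. Switching away from a
   common edge works for all but O(t + k) choices of a, whence
   (k + 1) p_{k+1} <= (1/2 + o(1)) p_k. Creating the common edge {u, v} of M needs
   R(u) and R(v) to be adjacent and not matched by M, which could fail for every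
   edge of M; but randomising the partner of u by one more switching shows that it
   fails for only O(t) edges of M on average, so that
   (k + 1) p_{k+1} - p_k / 2 -> 0. A last switching shows that the mean number of
   common edges is at most 1, hence no mass escapes, and (p_k) tends to the
   Poisson law of parameter 1/2 pointwise, thus in total variation by Scheffe's
   argument. *)
Require Import Defs.
From HB Require Import structures.
From mathcomp Require Import all_boot all_order all_algebra.
From mathcomp Require Import fingroup perm.
From mathcomp Require Import all_classical all_reals all_analysis.
From mathcomp Require Import zify ring lra.

Set Implicit Arguments.
Unset Strict Implicit.
Unset Printing Implicit Defensive.

Import Order.TTheory GRing.Theory Num.Theory.
Import numFieldNormedType.Exports.

(** * Switchings of perfect matchings, encoded as fixed-point-free involutions *)

Section Switching.
Local Open Scope nat_scope.
Context (T : finType) (g : simple_graph T).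
Implicit Types (f m : {perm T}) (u v a x z : T).

Definition matching f := [forall x, (f (f x) == x) && g x (f x)].

Definition matchings : {set {perm T}} := finset matching.

Lemma matchingP f :
  reflect ((forall x, f (f x) = x) /\ (forall x, g x (f x))) (matching f).
Proof.
apply: (iffP forallP) => [h|[h1 h2] x]; last by rewrite h1 eqxx h2.
by split=> x; case/andP: (h x) => // /eqP.
Qed.

Definition switch f u a : {perm T} := (f ^ tperm (f u) a)%g.

Lemma switchE f u a x : switch f u a x = tperm (f u) a (f (tperm (f u) a x)).
Proof.
by rewrite -[x in LHS](tpermK (f u) a) permJ.
Qed.

Lemma matching_neq f x : matching f -> f x != x.
Proof.
case/matchingP=> _ h; apply/eqP => e; have := h x.
by rewrite e adj_irrefl.
Qed.

Lemma matching_eqL f x z : matching f -> (f x == z) = (x == f z).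
Proof.
by case/matchingP=> h _; apply/eqP/eqP => [<-|->]; rewrite h.
Qed.

Lemma switchL f u a : matching f -> a != u -> switch f u a u = a.
Proof.
move=> fM au; rewrite switchE (tpermD _ au) ?tpermL //; exact: matching_neq.
Qed.

Lemma switchR f u a : matching f -> a != u -> switch f u a (f u) = f a.
Proof.
move=> fM au; rewrite switchE tpermL tpermD // 1?eq_sym ?(matching_neq _ fM)//.
by rewrite (inj_eq perm_inj).
Qed.

Lemma switchD f u a z : matching f ->
  z != f u -> z != a -> z != u -> z != f a -> switch f u a z = f z.
Proof.
move=> fM zu za zu' za'; rewrite switchE.
rewrite [tperm _ _ z]tpermD 1?eq_sym // tpermD // eq_sym.
  by rewrite (inj_eq perm_inj).
by rewrite (matching_eqL _ _ fM).
Qed.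

Lemma switchK f u a : matching f -> a != u ->
  switch (switch f u a) u (f u) = f.
Proof.
move=> fM au; rewrite {1}/switch switchL // tpermC /switch.
by rewrite -conjgM tperm2 conjg1.
Qed.

Lemma switch_involutive f u a : matching f -> forall x,
  switch f u a (switch f u a x) = x.
Proof.
by case/matchingP=> ff _ x; rewrite !switchE tpermK ff tpermK.
Qed.

(** Only the partners of [u], [f u], [a] and [f a] can change. The new edges at [u] and [f u] are
    the two hypotheses; at [a] and [f a] they are the same edges read from the other end. *)
Lemma switch_matching f u a : matching f -> a != u ->
  g u a -> g (f u) (f a) -> matching (switch f u a).
Proof.
move=> fM au gua gfua; have /matchingP[ff gf] := fM.
have sK := switch_involutive u a fM.
apply/matchingP; split=> // z.
have [->|zu] := eqVneq z u; first by rewrite switchL.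
have [->|zfu] := eqVneq z (f u); first by rewrite switchR.
have [->|za] := eqVneq z a.
  by rewrite -{3}(switchL fM au) sK adj_sym.
have [->|zfa] := eqVneq z (f a).
  by rewrite -{2}(switchR fM au) sK adj_sym.
by rewrite switchD.
Qed.

Lemma card_dep_pairs (U W : finType) (S : {set U}) (A : U -> pred W) :
  #|[pred p : U * W | (p.1 \in S) && A p.1 p.2]| = \sum_(x in S) #|A x|.
Proof.
rewrite -sum1_card.
rewrite (eq_bigl (fun p : U * W => (p.1 \in S) && A p.1 p.2)) //.
rewrite -(pair_big_dep (mem S) A (fun _ _ => 1)) /=.
by apply: eq_bigr => x _; rewrite sum1_card.
Qed.

(** Double counting of switches at [u]: [f] in [S] offers at least [d] targets [a], and by [switchK]
    the result together with the old partner [f u] determines [f] and [a]. [Q] restricts the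
    possible old partners, so a matching in [S'] is reached at most [s] times. *)
Lemma switch_count u (S S' : {set {perm T}}) (A Q : {perm T} -> pred T) d s :
  (forall f, f \in S -> matching f) ->
  (forall f, f \in S -> d <= #|A f|) ->
  (forall f a, f \in S -> A f a ->
     [/\ a != u, switch f u a \in S' & Q (switch f u a) (f u)]) ->
  (forall f, f \in S' -> #|Q f| <= s) ->
  #|S| * d <= #|S'| * s.
Proof.
move=> SM dA hA Qs.
apply: (@leq_trans (\sum_(f in S) #|A f|)).
  by rewrite -sum_nat_const leq_sum.
apply: (@leq_trans (\sum_(f in S') #|Q f|)); last first.
  by rewrite -sum_nat_const leq_sum.
rewrite -!card_dep_pairs.
pose F (p : {perm T} * T) := (switch p.1 u p.2, p.1 u).
have Finj : {in [pred p : {perm T} * T | (p.1 \in S) && A p.1 p.2] &, injective F}.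
  move=> [f a] [f' a'] /= /andP[/= fS Aa] /andP[/= fS' Aa'] [e1 e2].
  have [au _ _] := hA _ _ fS Aa; have [au' _ _] := hA _ _ fS' Aa'.
  have -> : f = f'.
    by rewrite -(switchK (SM _ fS) au) e1 e2 (switchK (SM _ fS') au').
  by rewrite -(switchL (SM _ fS) au) e1 (switchL (SM _ fS') au').
rewrite -(card_in_image Finj); apply: subset_leq_card.
apply/fintype.subsetP => _ /fintype.imageP[[f a] /andP[/= fS Aa] ->].
by have [_ ? ?] := hA _ _ fS Aa; apply/andP.
Qed.

(** * Counting switchings when every vertex has at most [t] non-neighbours *)

Section Codegree.
Variable t : nat.
Hypothesis codeg : forall x, #|[pred y | ~~ g x y]| <= t.

(** The excluded targets are the non-neighbours of [u], the partners of non-neighbours of [f u], and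
    [C]. *)
Lemma card_switchable f u (C : {set T}) :
  #|T| - (2 * t + #|C|) <=
  #|[pred a | [&& g u a, g (f u) (f a) & a \notin C]]|.
Proof.
pose N (x : T) := finset (fun y => ~~ g x y).
have cN x : #|N x| <= t by rewrite cardsE codeg.
rewrite leq_subLR -cardsT.
rewrite -(finset.setUCr (N u :|: (f @^-1: N (f u)) :|: C)%SET) -[X in _ <= _ + X]cardsE.
apply: leq_trans (leq_of_leqif (leq_card_setU _ _)) _; apply: leq_add.
  apply: leq_trans (leq_of_leqif (leq_card_setU _ _)) _; rewrite leq_add2r.
  apply: leq_trans (leq_of_leqif (leq_card_setU _ _)) _; rewrite mul2n -addnn leq_add //.
  by rewrite card_preimset //; exact: perm_inj.
apply: subset_leq_card; apply/fintype.subsetP => a.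
by rewrite !inE !negb_or !negbK andbA.
Qed.

(* Switching at [u] keeps the partner [f v] and randomises the partner of [u];
   the old partner of [u] is then one of the [s] elements related to [f v]. *)
Lemma few_bad_pairs (B : rel T) u v s :
  (forall y, #|[pred x | B x y]| <= s) -> u != v ->
  #|finset (fun f : {perm T} => [&& matching f, f u != v & B (f u) (f v)])|
    * (#|T| - (2 * t + 2)) <= #|matchings| * s.
Proof.
move=> Bs uv.
(* Avoiding [v] and [f v] as targets is what leaves the partner of [v] unchanged. *)
pose A f := [pred a | [&& g u a, g (f u) (f a) & a \notin [set v; f v]%SET]].
apply: (@switch_count u _ _ A (fun f => [pred x | B x (f v)])) => //.
- by move=> f; rewrite inE => /and3P[].
- move=> f; rewrite inE => /and3P[fM fuv _].
  apply: leq_trans (card_switchable f u [set v; f v]%SET).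
  by rewrite leq_sub2l // leq_add2l cards2; case: (_ != _).
- move=> f a; rewrite !inE => /and3P[fM fuv fB].
  case/and3P=> gua gfa; rewrite negb_or => /andP[av afv].
  have au : a != u by apply: contraTneq gua => ->; rewrite adj_irrefl.
  split=> //; first exact: switch_matching.
  rewrite /= switchD // 1?eq_sym //.
  by rewrite (matching_eqL _ _ fM).
- by move=> f _; exact: Bs.
Qed.

Definition agree f m : {set T} := finset (fun z => f z == m z).

(** The agreements at [u] and [f u] are lost and none is gained: the new edges could be in [m] only
    if [a] were [f u], which is ruled out because [f] and [m] agree at [f u]. *)
Lemma card_agree_switch f m u a : matching f -> matching m ->
  f u = m u -> f a != m a -> #|agree f m| = #|agree (switch f u a) m|.+2.
Proof.
move=> fM mM fu fa.
have au : a != u by apply: contraNneq fa => ->; rewrite fu.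
have [ff gf] := matchingP _ fM; have [mm _] := matchingP _ mM.
have afu : a != f u by apply: contraNneq fa => ->; rewrite ff fu mm.
have ufu : u != f u by rewrite eq_sym matching_neq.
have fuA : f u \in agree f m by rewrite inE ff fu mm.
rewrite (cardsD1 u) inE fu eqxx /= (cardsD1 (f u)) !inE.
rewrite ff {2}fu mm eqxx eq_sym ufu /=; congr (_.+2).
apply: eq_card => z; rewrite !inE.
have [->|zfu] := eqVneq z (f u).
  by rewrite /= switchR // {1}fu mm (matching_eqL _ _ fM) (negPf afu).
have [->|zu] := eqVneq z u.
  by rewrite /= switchL // -fu (negPf afu).
have [->|za] /= := eqVneq z a.
  have -> : switch f u a a = u.
    by rewrite -{2}(switchL fM au) switch_involutive.
  by rewrite (negPf fa) -[u in RHS]mm -fu (inj_eq perm_inj) eq_sym (negPf afu).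
have [->|zfa] := eqVneq z (f a); last by rewrite switchD.
have -> : switch f u a (f a) = f u.
  by rewrite -{1}(switchR fM au) switch_involutive.
rewrite ff fu (inj_eq perm_inj) [RHS]eq_sym (matching_eqL _ _ fM).
by rewrite (negPf afu) -(matching_eqL _ _ mM) eq_sym (negPf fa).
Qed.

(** Agreement is counted by vertices, two for each common edge, hence the factor 2. *)
Definition level m k : {set {perm T}} :=
  finset (fun f : {perm T} => (matching f) && (#|agree f m| == 2 * k)).

(** Targets avoid the [2 * k.+1] agreeing vertices, so exactly one common edge is lost. The old
    partner of [u] must be [m u], so each result is reached at most once. *)
Lemma level_up m k u : matching m ->
  #|finset (fun f : {perm T} => (f \in level m k.+1) && (f u == m u))|
    * (#|T| - (2 * t + 2 * k.+1)) <=
  #|finset (fun f : {perm T} => (f \in level m k) && (f u != m u))|.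
Proof.
move=> mM; rewrite -[leqRHS]muln1.
pose A f := [pred a | [&& g u a, g (f u) (f a) & a \notin agree f m]].
apply: (@switch_count u _ _ A (fun _ => pred1 (m u))) => //.
- by move=> f; rewrite !inE -andbA => /and3P[].
- move=> f; rewrite !inE -andbA => /and3P[fM /eqP <- _].
  exact: card_switchable.
- move=> f a; rewrite !inE -andbA => /and3P[fM /eqP fk /eqP fu].
  case/and3P=> gua gfa; rewrite ?inE => fa.
  have au : a != u by apply: contraTneq gua => ->; rewrite adj_irrefl.
  have afu : a != f u.
    apply: contraNneq fa => ->.
    have [ff _] := matchingP _ fM; have [mm _] := matchingP _ mM.
    by rewrite ff fu mm.
  split=> //; last by rewrite fu.
  move: fk; rewrite (card_agree_switch fM mM fu fa) => fk.
  rewrite -!andbA switch_matching ?switchL // -fu afu andbT /=; apply/eqP; lia.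
- by move=> f _; rewrite card1.
Qed.

(** The two obstacles to creating the common edge [{u, m u}]: the other new edge [{f u, f (m u)}] is
    missing from the graph, or it lies in [m] as well, so that two common edges would appear at
    once. *)
Definition unswitchable m f u :=
  ~~ g (f u) (f (m u)) || (m (f u) == f (m u)).

(** The only target is [m u], while the old partner of [u] may be any vertex, hence the factor
    [#|T|]. *)
Lemma level_down m k u : matching m ->
  #|finset (fun f : {perm T} =>
       [&& f \in level m k, f u != m u & ~~ unswitchable m f u])| <=
  #|finset (fun f : {perm T} => (f \in level m k.+1) && (f u == m u))| * #|T|.
Proof.
move=> mM; rewrite -[leqLHS]muln1.
have [mm gm] := matchingP _ mM.
pose A (f : {perm T}) := [pred a | (a == m u) && g u a].
apply: (@switch_count u _ _ A (fun _ => predT)) => //.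
- by move=> f; rewrite !inE -andbA => /and3P[].
- move=> f _; rewrite (@eq_card _ _ (pred1 (m u))) ?card1 // => a; rewrite !inE.
  by have [->|//] := eqVneq a (m u); rewrite gm.
- move=> f a; rewrite !inE -andbA => /and4P[fM /eqP fk fu].
  rewrite negb_or negbK => /andP[ga mfu] /andP[/eqP -> gua].
  have au : m u != u by rewrite matching_neq.
  have sM : matching (switch f u (m u)) by rewrite switch_matching.
  split=> //; rewrite sM switchL // eqxx andbT /=.
  (* The agreement count is read backwards: switching the new matching towards [f u] destroys the
     edge just created and restores [f]. *)
  rewrite (@card_agree_switch (switch f u (m u)) m u (f u)) ?switchK ?switchL //.
    by rewrite fk; apply/eqP; lia.
  by rewrite switchR // eq_sym.
Qed.

Lemma common_edge_count m u : matching m ->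
  #|finset (fun f : {perm T} => (matching f) && (f u == m u))|
    * (#|T| - 2 * t) <= #|matchings|.
Proof.
move=> mM; rewrite -[leqRHS]muln1.
pose A f := [pred a | [&& g u a, g (f u) (f a) & a \notin finset.set0]].
apply: (@switch_count u _ _ A (fun _ => pred1 (m u))) => //.
- by move=> f; rewrite !inE => /andP[].
- move=> f _; apply: leq_trans (card_switchable f u finset.set0).
  by rewrite cards0 addn0.
- move=> f a; rewrite inE => /andP[fM fu] /and3P[gua gfa _].
  have au : a != u by apply: contraTneq gua => ->; rewrite adj_irrefl.
  by split=> //; rewrite inE; exact: switch_matching.
- by move=> f _; rewrite card1.
Qed.

Lemma sum_card_fibers (S : {set {perm T}}) (C : {perm T} -> {set T}) :
  \sum_(u : T) #|finset (fun f : {perm T} => (f \in S) && (u \in C f))| =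
  \sum_(f in S) #|C f|.
Proof.
under eq_bigr => u _ do rewrite cardsE -sum1_card big_mkcondr /=.
by rewrite exchange_big /=; apply: eq_bigr => f _; rewrite -big_mkcond sum1_card.
Qed.

Lemma sum_level_agree m k :
  \sum_u #|finset (fun f : {perm T} => (f \in level m k) && (f u == m u))| =
  #|level m k| * (2 * k).
Proof.
transitivity (\sum_(f in level m k) #|agree f m|).
  rewrite -sum_card_fibers; apply: eq_bigr => u _.
  by apply: eq_card => f; rewrite !inE.
rewrite -sum_nat_const; apply: eq_bigr => f.
by rewrite inE => /andP[_ /eqP].
Qed.

Lemma sum_level_disagree m k :
  \sum_u #|finset (fun f : {perm T} => (f \in level m k) && (f u != m u))| =
  #|level m k| * (#|T| - 2 * k).
Proof.
transitivity (\sum_(f in level m k) #|~: agree f m|%SET).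
  rewrite -sum_card_fibers; apply: eq_bigr => u _.
  by apply: eq_card => f; rewrite !inE.
rewrite -sum_nat_const; apply: eq_bigr => f.
by rewrite inE => /andP[_ /eqP fk]; rewrite finset.cardsCs finset.setCK fk.
Qed.

Lemma level_upper m k : matching m ->
  #|level m k.+1| * (2 * k.+1) * (#|T| - (2 * t + 2 * k.+1)) <=
  #|level m k| * (#|T| - 2 * k).
Proof.
move=> mM; rewrite -sum_level_agree -sum_level_disagree big_distrl /=.
by apply: leq_sum => u _; exact: level_up.
Qed.

(** Summing [level_down] over [u] loses only the unswitchable pairs. [few_bad_pairs], applied with
    [v] equal to [m u], bounds these over all matchings, whatever their level. *)
Lemma level_lower m k : matching m ->
  (#|level m k| * (#|T| - 2 * k) - #|level m k.+1| * (2 * k.+1) * #|T|)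
    * (#|T| - (2 * t + 2)) <= #|T| * (#|matchings| * t.+1).
Proof.
move=> mM; have [mm gm] := matchingP _ mM.
pose B x y := ~~ g x y || (m x == y).
(* Besides the at most [t] non-neighbours of [y], only [m y] can be related to [y]. *)
have Bt y : #|[pred x | B x y]| <= t.+1.
  have sub : [pred x | B x y] \subset [predU1 m y & [pred z | ~~ g y z]].
    apply/fintype.subsetP => x; rewrite !inE /B adj_sym => /orP[->|/eqP <-].
      by rewrite orbT.
    by rewrite mm eqxx.
  apply: leq_trans (subset_leq_card sub) _.
  rewrite cardU1; apply: leq_trans (leq_add (leq_b1 _) (codeg y)) _.
  by rewrite add1n.
pose bad u := finset (fun f : {perm T} =>
  [&& matching f, f u != m u & B (f u) (f (m u))]).
have sum_bad : (\sum_u #|bad u|) * (#|T| - (2 * t + 2)) <=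
    #|T| * (#|matchings| * t.+1).
  rewrite big_distrl /= -sum_nat_const; apply: leq_sum => u _.
  by apply: few_bad_pairs Bt _; rewrite eq_sym matching_neq.
apply: leq_trans sum_bad; rewrite leq_mul2r; apply/orP; right.
rewrite leq_subLR -sum_level_agree -sum_level_disagree big_distrl /= -big_split.
apply: leq_sum => u _ /=.
apply: leq_trans (leq_add (level_down k u mM) (leqnn _)).
apply: leq_trans (leq_of_leqif (leq_card_setU _ _)).
apply: subset_leq_card; apply/fintype.subsetP => f.
rewrite !inE /unswitchable /B => /andP[/andP[-> ->] ->] /=.
by rewrite orNb.
Qed.

Lemma sum_agree_le m : matching m ->
  (\sum_(f in matchings) #|agree f m|) * (#|T| - 2 * t) <= #|T| * #|matchings|.
Proof.
move=> mM; rewrite -sum_card_fibers big_distrl /= -sum_nat_const.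
apply: leq_sum => u _; apply: leq_trans (common_edge_count u mM).
rewrite leq_mul2r; apply/orP; right; apply: subset_leq_card.
by apply/fintype.subsetP => f; rewrite !inE.
Qed.

End Codegree.

(** * Correspondence between involutions and perfect matchings as edge sets *)

Definition edge_set f : {set {set T}} := ((fun x => [set x; f x]) @: T)%SET.

Lemma mem_edge_set f x : [set x; f x]%SET \in edge_set f.
Proof. exact: imset_f. Qed.

Lemma edge_setP f (A : {set T}) z : matching f -> A \in edge_set f ->
  z \in A -> A = [set z; f z]%SET.
Proof.
move=> /matchingP[ff _] /imsetP[x _ ->]; rewrite !inE => /orP[/eqP->//|/eqP->].
by rewrite ff finset.setUC.
Qed.

Lemma set2_inj z (a b : T) : a != z -> [set z; a]%SET = [set z; b]%SET -> a = b.
Proof.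
move=> az /setP /(_ a); rewrite !inE eqxx orbT (negPf az) /= => /esym /eqP //.
Qed.

Lemma edge_set_perfect f : matching f -> perfect_matching g (edge_set f).
Proof.
move=> fM; have [ff gf] := matchingP _ fM; apply/and3P; split.
- apply/fintype.subsetP => _ /imsetP[x _ ->]; rewrite inE.
  by apply/existsP; exists x; apply/existsP; exists (f x); rewrite gf eqxx.
- apply/finset.trivIsetP => A B AE BE; apply: contraNT => /pred0Pn[z /andP[/= zA zB]].
  by rewrite (edge_setP fM AE zA) (edge_setP fM BE zB).
- rewrite finset.eqEsubset finset.subsetT; apply/fintype.subsetP => x _.
  apply/finset.bigcupP; exists [set x; f x]%SET; last by rewrite !inE eqxx.
  exact: mem_edge_set.
Qed.

Lemma edge_set_inj : {in matchings &, injective edge_set}.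
Proof.
move=> f h; rewrite !inE => fM hM e; apply/permP => x.
have fx : [set x; f x]%SET \in edge_set h by rewrite -e mem_edge_set.
apply: (@set2_inj x); first exact: matching_neq.
by apply: (edge_setP hM fx); rewrite !inE eqxx.
Qed.

(** Covering gives each vertex a mate and disjointness makes it unique, so taking mates is an
    involution. *)
Lemma perfect_matching_edge_set (R : {set {set T}}) :
  perfect_matching g R -> exists2 f, matching f & R = edge_set f.
Proof.
case/and3P=> /fintype.subsetP RE /finset.trivIsetP Rtriv /eqP Rcover.
have Rpair A x : A \in R -> x \in A -> exists2 y, g x y & A = [set x; y]%SET.
  move=> AR xA; have := RE _ AR; rewrite inE => /existsP[p /existsP[q]].
  case/andP=> gpq /eqP eA; move: xA; rewrite eA !inE => /orP[]/eqP->.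
    by exists q.
  by exists p; rewrite 1?adj_sym // finset.setUC.
have gneq x y : g x y -> y != x.
  by apply: contraTneq => ->; rewrite adj_irrefl.
(* The default [x] is never taken, since [R] covers every vertex. *)
pose mate x := odflt x [pick y | g x y && ([set x; y]%SET \in R)].
have mateP x : g x (mate x) /\ [set x; mate x]%SET \in R.
  rewrite /mate; case: pickP => [y /andP[//]|no].
  have /finset.bigcupP[A AR xA] : x \in finset.cover R by rewrite Rcover inE.
  have [y gxy eA] := Rpair A x AR xA.
  by have := no y; rewrite gxy -eA AR.
have mate_uniq x A : A \in R -> x \in A -> A = [set x; mate x]%SET.
  move=> AR xA; apply/eqP; apply: contraT => /(Rtriv _ _ AR (mateP x).2).
  by move/pred0P/(_ x); rewrite /= xA !inE eqxx.
have mateK x : mate (mate x) = x.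
  apply: (@set2_inj (mate x)); first exact: gneq (mateP _).1.
  rewrite -(mate_uniq (mate x) _ (mateP x).2); first exact: finset.setUC.
  by rewrite !inE eqxx orbT.
pose f := perm (can_inj mateK).
exists f; first by apply/matchingP; split=> x; rewrite !permE // (mateP x).1.
apply/setP => A; apply/idP/imsetP => [AR|[x _ ->]]; last first.
  by rewrite permE (mateP x).2.
have := RE _ AR; rewrite inE => /existsP[x /existsP[y /andP[_ /eqP eA]]].
by exists x => //; rewrite permE; apply: mate_uniq => //; rewrite eA !inE eqxx.
Qed.

(** The agreement set is the disjoint union of the common edges, each having two vertices. *)
Lemma card_common_edges f m : matching f -> matching m ->
  #|agree f m| = 2 * #|edge_set m :&: edge_set f|%SET.
Proof.
move=> fM mM; set I := (_ :&: _)%SET.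
have Itriv : finset.trivIset I.
  have /and3P[_ ftriv _] := edge_set_perfect fM.
  by apply: finset.trivIsetS ftriv; exact: finset.subsetIr.
have -> : agree f m = finset.cover I.
  apply/setP => z; rewrite inE; apply/eqP/finset.bigcupP => [fz|[A]].
    exists [set z; f z]%SET; last by rewrite !inE eqxx.
    by rewrite inE {1}fz !mem_edge_set.
  rewrite inE => /andP[Am Af] zA; apply: (@set2_inj z).
    exact: matching_neq.
  by rewrite -(edge_setP fM Af zA) (edge_setP mM Am zA).
rewrite -(eqP Itriv) mulnC -sum_nat_const; apply: eq_bigr => A.
rewrite inE => /andP[_ /imsetP[x _ ->]].
by rewrite cards2 eq_sym matching_neq.
Qed.

(** * Counting inequalities for matchings sharing exactly [k] edges with [M] *)

Definition sharing (M : {set {set T}}) k : {set {set {set T}}} :=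
  finset (fun R : {set {set T}} =>
    perfect_matching g R && (#|M :&: R|%SET == k)).

Lemma card_sharing m k : matching m ->
  #|sharing (edge_set m) k| = #|level m k|.
Proof.
move=> mM; rewrite -(card_in_imset (f := edge_set) (D := level m k)); last first.
  move=> f h; rewrite !inE => /andP[fM _] /andP[hM _].
  by apply: edge_set_inj; rewrite inE.
apply: eq_card => R; rewrite !inE; apply/andP/imsetP => [[Rpm Rk]|[f]].
  have [f fM eR] := perfect_matching_edge_set Rpm; exists f => //.
  by rewrite inE fM card_common_edges // -eR eqn_pmul2l.
rewrite inE => /andP[fM fk] ->; rewrite edge_set_perfect //.
by move: fk; rewrite card_common_edges // eqn_pmul2l.
Qed.

Lemma perfect_matchingsE : finset (perfect_matching g) = (edge_set @: matchings)%SET.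
Proof.
apply/setP => R; rewrite inE; apply/idP/imsetP => [Rpm|[f]].
  have [f fM ->] := perfect_matching_edge_set Rpm.
  by exists f; rewrite ?inE.
by rewrite inE => fM ->; exact: edge_set_perfect.
Qed.

Lemma card_perfect_matchings : #|perfect_matching g| = #|matchings|.
Proof.
rewrite -(card_in_imset edge_set_inj) -perfect_matchingsE.
by apply: eq_card => R; rewrite !inE.
Qed.

Lemma sum_sharing_le (M : {set {set T}}) K :
  \sum_(k < K) #|sharing M k| <= #|perfect_matching g|.
Proof.
rewrite -sum1_card.
under [leqLHS]eq_bigr => k _ do rewrite /sharing -sum1dep_card big_mkcondr /=.
rewrite exchange_big /=; apply: leq_sum => R _.
rewrite -big_mkcond sum1_card.
have [lt|ge] := ltnP #|M :&: R|%SET K.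
  rewrite (@eq_card _ _ (pred1 (Ordinal lt))) ?card1 // => i.
  by rewrite !inE -val_eqE eq_sym.
rewrite eq_card0 // => i; rewrite !inE.
by apply: contraTF ge => /eqP ->; rewrite -ltnNge.
Qed.

Section Sharing.
Variables (t n : nat) (M : {set {set T}}).
Hypothesis card_T : #|T| = 2 * n.
Hypothesis codeg : forall x, #|[pred y | ~~ g x y]| <= t.
Hypothesis MP : perfect_matching g M.

Let c k := #|sharing M k|.
Let N := #|perfect_matching g|.

Lemma sharing_upper k : c k.+1 * k.+1 * (2 * (n - (t + k.+1))) <= c k * n.
Proof.
have [m mM eM] := perfect_matching_edge_set MP.
have := level_upper codeg k mM; rewrite /c eM !card_sharing // card_T.
rewrite -!mulnDr -!mulnBr => h; rewrite -(@leq_pmul2l 2) //.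
apply: leq_trans (leq_trans h _); first by nia.
by rewrite mulnCA leq_mul2l leq_mul2l leq_subr !orbT.
Qed.

Lemma sharing_lower k : 2 * t + 2 <= n ->
  c k * (n - k) <= c k.+1 * k.+1 * (2 * n) + N * t.+1.
Proof.
have [m mM eM] := perfect_matching_edge_set MP => tn.
have := level_lower codeg k mM.
rewrite /c /N card_perfect_matchings eM !card_sharing // card_T.
move: #|level m k| #|level m k.+1| #|matchings| => a b d.
have n0 : 0 < n by lia.
set X := _ - _ => h.
(* Since [2 * t + 2 <= n], the factor [2 * n - (2 * t + 2)] is at least [n], and [n] cancels. *)
have : X <= 2 * (d * t.+1).
  rewrite -(leq_pmul2r n0); apply: (@leq_trans (X * (2 * n - (2 * t + 2)))).
    by rewrite leq_mul2l; apply/orP; right; lia.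
  by apply: leq_trans h _; nia.
by rewrite /X; nia.
Qed.

(** Markov's inequality: on average at most one edge is shared, and a matching sharing at least [K]
    edges contributes at least [K] to the total. *)
Lemma sharing_tail K : 2 * t <= n -> 0 < n ->
  N * K <= (\sum_(k < K) c k) * K + N.
Proof.
move=> tn n0; have [m mM eM] := perfect_matching_edge_set MP.
have mean : \sum_(R | perfect_matching g R) #|M :&: R|%SET <= N.
  have := sum_agree_le codeg mM.
  rewrite -card_perfect_matchings -/N card_T.
  have -> : \sum_(f in matchings) #|agree f m| =
            2 * \sum_(R | perfect_matching g R) #|M :&: R|%SET.
    have pmE R : perfect_matching g R = (R \in edge_set @: matchings)%SET.
      by rewrite -perfect_matchingsE inE.
    rewrite (eq_bigl _ _ pmE) big_distrr /= big_imset /=; last exact: edge_set_inj.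
    by apply: eq_bigr => f; rewrite inE => fM; rewrite card_common_edges // eM.
  by move: (\sum_(R | _) _) => S h; rewrite -(leq_pmul2l n0); nia.
apply: leq_trans (leq_add (leqnn _) mean).
rewrite big_distrl /= /N -sum1_card big_distrl /=.
under [X in _ <= X + _]eq_bigr => k _ do
  rewrite /c /sharing -sum1dep_card big_mkcondr big_distrl /=.
rewrite exchange_big -big_split /=; apply: leq_sum => R _; rewrite mul1n.
have [lt|ge] := ltnP #|M :&: R|%SET K; last exact: leq_trans ge (leq_addl _ _).
by rewrite (bigD1 (Ordinal lt)) //= eqxx mul1n -addnA leq_addr.
Qed.

End Sharing.

End Switching.

Local Open Scope classical_set_scope.
Local Open Scope ring_scope.

(** * From an asymptotic recurrence and tightness to Poisson limits *)

Section PoissonLimit.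
Context (R : realType) (lambda : R) (p : nat -> nat -> R).
Hypothesis p_ge0 : forall n k, 0 <= p n k.
Hypothesis p_sum : forall n K, \sum_(k < K) p n k <= 1.
Hypothesis p_tail : forall K, (0 < K)%N ->
  \forall n \near \oo, 1 - \sum_(k < K) p n k <= K%:R^-1.
Hypothesis p_rec : forall k,
  (fun n => k.+1%:R * p n k.+1 - lambda * p n k) @ \oo --> (0 : R).

Let c := exp_coeff lambda.

(** The coefficients [c k], that is lambda^k / k!, satisfy the recurrence exactly, so the error at
    [k.+1] is a fixed multiple of the error at [k] plus a vanishing term. Only the normalisation
    [p n 0] stays undetermined. *)
Lemma profile_limit k : (fun n => p n k - p n 0%N * c k) @ \oo --> (0 : R).
Proof.
elim: k => [|k IH].
  rewrite (_ : (fun _ => _) = fun=> 0); first exact: cvg_cst.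
  by apply/funext => n; rewrite /c /exp_coeff /= expr0 fact0 divr1 mulr1 subrr.
rewrite (_ : (fun _ => _) = (fun n =>
    k.+1%:R^-1 * (k.+1%:R * p n k.+1 - lambda * p n k) +
    lambda / k.+1%:R * (p n k - p n 0%N * c k))); last first.
  apply/funext => n; rewrite /c /exp_coeff /= factS natrM exprS.
  by field; rewrite nat1r !pnatr_eq0 -lt0n fact_gt0.
rewrite -[0%R](addr0 0).
apply: cvgD.
  by rewrite -(mulr0 k.+1%:R^-1); apply: cvgMl_tmp; exact: p_rec.
by rewrite -(mulr0 (lambda / k.+1%:R)); apply: cvgMl_tmp; exact: IH.
Qed.

Lemma profile_sum_limit K :
  (fun n => \sum_(k < K) p n k - p n 0%N * \sum_(k < K) c k) @ \oo --> (0 : R).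
Proof.
elim: K => [|K IH].
  rewrite (_ : (fun _ => _) = fun=> 0); first exact: cvg_cst.
  by apply/funext => n; rewrite !big_ord0 mulr0 subrr.
rewrite (_ : (fun _ => _) = (fun n =>
    (\sum_(k < K) p n k - p n 0%N * \sum_(k < K) c k) +
    (p n K - p n 0%N * c K))); last first.
  by apply/funext => n; rewrite !big_ord_recr /=; ring.
by have := cvgD IH (profile_limit K); rewrite addr0; apply.
Qed.

Lemma exp_coeff_sum_cvg : (fun K => \sum_(k < K) c k) @ \oo --> expR lambda.
Proof.
rewrite (_ : (fun _ => _) = series c); last first.
  by apply/funext => K; rewrite /series /= big_mkord.
rewrite expRE /c exp_coeffE.
by have := @is_cvg_series_exp_coeff R lambda; rewrite exp_coeffE; apply.
Qed.

Lemma poisson_limit k : (p ^~ k) @ \oo --> c k * expR (- lambda).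
Proof.
have p0 : (p ^~ 0%N) @ \oo --> expR (- lambda).
  suff h : (fun n => p n 0%N * expR lambda) @ \oo --> (1 : R).
    rewrite (_ : p ^~ 0%N = (fun n => expR (- lambda) * (p n 0%N * expR lambda))).
      by have := @cvgMl_tmp _ _ _ _ _ (expR (- lambda)) _ h; rewrite mulr1; apply.
    by apply/funext => n; rewrite mulrCA -expRD addNr expR0 mulr1.
  apply/cvgrPdist_le => e e0.
  have e3 : 0 < e / 3 by rewrite divr_gt0.
  (* Three errors of e/3 separate [p n 0 * expR lambda] from 1: the tail of the exponential series,
     the mass of [p n] beyond [K], and the profile error below [K]. *)
  have [K [K0 [KS Ke]]] : exists K, [/\ (0 < K)%N,
      `|expR lambda - \sum_(k < K) c k| <= e / 3 & K%:R^-1 <= e / 3].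
    have /cvgrPdist_le/(_ _ e3) h1 := exp_coeff_sum_cvg.
    have h2 : \forall K \near \oo, (K%:R^-1 : R) <= e / 3.
      near=> K; rewrite -(invrK (e / 3)) lef_pV2 ?posrE ?invr_gt0 //.
        by near: K; exact: nbhs_infty_ger.
      by rewrite ltr0n; near: K; exact: nbhs_infty_gt.
    have h3 : \forall K \near \oo, (0 < K)%N by exact: nbhs_infty_gt.
    have [K [? [? ?]]] := filter_ex (filterI h1 (filterI h2 h3)).
    by exists K.
  have h1 := p_tail K0.
  have /cvgrPdist_le/(_ _ e3) h2 := profile_sum_limit K.
  near=> n.
  have h1n : 1 - \sum_(k < K) p n k <= K%:R^-1 by near: n.
  have : `|0 - (\sum_(k < K) p n k - p n 0%N * \sum_(k < K) c k)| <= e / 3.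
    by near: n.
  have : `|p n 0%N * (expR lambda - \sum_(k < K) c k)| <= e / 3.
    rewrite normrM; apply: le_trans KS; rewrite ler_piMl //.
    rewrite ger0_norm //; have := p_sum n 1%N.
    by rewrite big_ord1.
  have := p_sum n K.
  rewrite !ler_norml mulrBr; move: Ke h1n.
  move: (\sum_(k < K) p n k) (p n 0%N * \sum_(k < K) c k).
  move: (p n 0%N * expR lambda) (K%:R^-1 : R).
  move=> z w x y ? ? ? /andP[? ?] /andP[? ?].
  apply/andP; split; lra.
rewrite (_ : p ^~ k = (fun n => (p n k - p n 0%N * c k) + p n 0%N * c k)).
  have := cvgD (profile_limit k) (@cvgMr_tmp _ _ _ _ _ _ (c k) p0).
  by rewrite add0r [expR _ * _]mulrC; apply.
by apply/funext => n; rewrite subrK.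
Unshelve. all: by end_near.
Qed.

End PoissonLimit.

(** * Laws of integer-valued variables and total variation *)

Lemma esum_int (R : realType) (f : int -> \bar R) :
  (forall k, 0 <= f k)%E -> (forall k, f (Negz k) = 0%E) ->
  (\esum_(k in [set: int]) f k = \sum_(0 <= k <oo) f (Posz k))%E.
Proof.
move=> f0 fN; rewrite nneseries_esumT //.
rewrite -(@reindex_esum R nat int setT (range Posz)); last first.
  by split=> [k _|k l _ _ [//]|k []]; [exists k|move=> l _ <-; exists l].
rewrite [RHS]esum_mkcond; apply: eq_esum => -[] k _.
  by rewrite mem_set //; exists k.
by case: ifP => // _; rewrite fN.
Qed.

Lemma uniformly_distributed_preimage (R : realType) (d : measure_display)
    (Omega : measurableType d) (P : probability Omega R)
    (F : finType) (A : pred F) (X : Omega -> F) (Q : pred F) :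
  uniformly_distributed P A X ->
  P (X @^-1` [set` Q]) = (#|[pred a | A a && Q a]|%:R / #|A|%:R)%:E.
Proof.
move=> hX.
have -> : X @^-1` [set` Q] = \bigcup_(a in [set` Q]) (X @^-1` [set a]).
  by apply/seteqP; split=> [w Qw|w [a Qa /= ->//]]; exists (X w).
rewrite measure_fin_bigcup //; first last.
- by move=> a _; exact: (hX a).1.
- by move=> a b _ _ [w [/= <- <-]].
rewrite -(bigfs _ (index_enum_uniq F)); last first.
  by move=> a _; rewrite mem_index_enum.
transitivity (\sum_(a | Q a) (if A a then (#|A|%:R)^-1 else 0 : R)%:E)%E.
  by apply: eq_bigr => a _; exact: (hX a).2.
rewrite sumEFin -big_mkcondr /= sumr_const mulr_natl; congr (_ *+ _)%:E.
by apply: eq_card => a; rewrite !inE andbC.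
Qed.

Lemma poisson_prob_set1 (R : realType) (lambda : R) k : 0 < lambda ->
  Po lambda [set k] = (exp_coeff lambda k * expR (- lambda))%:E.
Proof.
move=> l0; rewrite /poisson_prob l0 esum_set1 ?lee_fin ?poisson_pmf_ge0 //.
by rewrite /poisson_pmf l0.
Qed.

(* Scheffe's argument: the mass that either law puts outside [0, K) is
   controlled by that of the second law and by the discrepancy on [0, K). *)
Lemma dTV_le (R : realType) (d1 : measure_display) (Omega1 : measurableType d1)
    (P1 : probability Omega1 R) (X : Omega1 -> nat)
    (d2 : measure_display) (Omega2 : measurableType d2)
    (P2 : probability Omega2 R) (Y : Omega2 -> nat) (a b : nat -> R) K :
  (forall k, P1 (X @^-1` [set k]) = (a k)%:E) ->
  (forall k, P2 (Y @^-1` [set k]) = (b k)%:E) ->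
  (forall m, \sum_(k < m) a k <= 1) -> (forall m, \sum_(k < m) b k <= 1) ->
  (dTV P1 (fun w => Posz (X w)) P2 (fun w => Posz (Y w)) <=
    (\sum_(k < K) `|a k - b k| + (1 - \sum_(k < K) b k))%:E)%E.
Proof.
move=> Xa Yb a1 b1.
have a0 k : 0 <= a k by rewrite -lee_fin -Xa measure_ge0.
have b0 k : 0 <= b k by rewrite -lee_fin -Yb measure_ge0.
have preP (T : Type) (Z : T -> nat) k :
    (fun w => Posz (Z w)) @^-1` [set Posz k] = Z @^-1` [set k].
  by apply/seteqP; split=> w /= => [[]|->].
have preN (T : Type) (Z : T -> nat) k :
    (fun w => Posz (Z w)) @^-1` [set Negz k] = set0.
  by apply/seteqP; split=> w.
rewrite /dTV esum_int; [|by []|]; last first.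
  by move=> k; rewrite !preN !measure0 sube0 abse0.
under eq_eseriesr => k _ do rewrite !preP Xa Yb -EFinB abse_EFin.
set S := \sum_(k < K) _; set B := \sum_(k < K) b k.
suff h : (\sum_(0 <= k <oo) `|a k - b k|%:E <= (2 * (S + (1 - B)))%:E)%E.
  apply: le_trans (lee_wpmul2l _ h) _; first by rewrite lee_fin.
  by rewrite -EFinM lee_fin mulrA mulVf // mul1r.
(* Hence the first law has mass at most [1 - B + S] beyond [K]. Adding [S] and the second tail
   [1 - B] gives twice the bound, which the factor 1/2 of [dTV] compensates. *)
have SB : B - S <= \sum_(k < K) a k.
  rewrite lerBlDr -big_split /=; apply: ler_sum => k _.
  by rewrite -lerBlDl distrC ler_norm.
apply: lime_le; first by apply: is_cvg_nneseries => k _ _; rewrite lee_fin.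
near=> m; have Km : (K <= m)%N by near: m; exact: nbhs_infty_ge.
rewrite sumEFin lee_fin (big_cat_nat (leq0n K) Km) //= big_mkord -/S.
have tail (u : nat -> R) : \sum_(k < m) u k <= 1 ->
    \sum_(K <= k < m) u k <= 1 - \sum_(k < K) u k.
  by rewrite -(big_mkord xpredT u) (big_cat_nat (leq0n K) Km) //= big_mkord lerBrDl.
have : \sum_(K <= k < m) `|a k - b k| <=
    \sum_(K <= k < m) a k + \sum_(K <= k < m) b k.
  rewrite -big_split /=; apply: ler_sum => k _.
  by apply: le_trans (ler_normB _ _) _; rewrite !ger0_norm.
move: (tail a (a1 m)) (tail b (b1 m)); rewrite -/B; lra.
Unshelve. all: by end_near.
Qed.

(** * From minimum degree to sharing probabilities *)

Lemma min_degree_le (T : finType) (G : simple_graph T) x :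
  (min_degree G <= degree G x)%N.
Proof.
rewrite /min_degree; elim: (index_enum T) (mem_index_enum x) => // y s IH.
rewrite inE big_cons => /orP[/eqP <-|/IH]; first exact: geq_minl.
by apply: leq_trans; exact: geq_minr.
Qed.

Lemma codegree_le (T : finType) (G : simple_graph T) x :
  (#|[pred y | ~~ G x y]| <= #|T| - min_degree G)%N.
Proof.
apply: leq_trans (leq_sub2l _ (min_degree_le G x)).
by rewrite -(cardC (G x)) addKn.
Qed.

Section SharingProbability.
Context (R : realType) (T : finType) (G : simple_graph T).
Variables (t n : nat) (M : {set {set T}}).
Hypothesis card_T : #|T| = (2 * n)%N.
Hypothesis codeg : forall x, (#|[pred y | ~~ G x y]| <= t)%N.
Hypothesis MP : perfect_matching G M.

Definition sharing_prob k : R :=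
  #|sharing G M k|%:R / #|perfect_matching G|%:R.

Let N_gt0 : (0 : R) < #|perfect_matching G|%:R.
Proof. by rewrite ltr0n; apply/card_gt0P; exists M. Qed.

Lemma sharing_prob_ge0 k : 0 <= sharing_prob k.
Proof. by rewrite divr_ge0. Qed.

Lemma sum_sharing_prob_le1 K : \sum_(k < K) sharing_prob k <= 1.
Proof.
by rewrite -mulr_suml ler_pdivrMr // mul1r -natr_sum ler_nat sum_sharing_le.
Qed.

Lemma sharing_prob_le1 k : sharing_prob k <= 1.
Proof.
apply: le_trans (sum_sharing_prob_le1 k.+1).
by rewrite big_ord_recr /= lerDr sumr_ge0 // => i _; exact: sharing_prob_ge0.
Qed.

(** Both counting inequalities are divided by the number of perfect matchings; their error terms are
    then bounded using that probabilities are at most 1. *)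
Lemma sharing_prob_rec k : (0 < n)%N -> (2 * t + 2 <= n)%N ->
  `|k.+1%:R * sharing_prob k.+1 - 2^-1 * sharing_prob k|
    <= k.+1%:R * (t + k.+1)%:R / n%:R.
Proof.
move=> n0 tn; have nR : (0 : R) < n%:R by rewrite ltr0n.
have upper := sharing_upper card_T codeg MP k.
have lower := sharing_lower card_T codeg MP k tn.
have p1 := sharing_prob_le1 k; have p1' := sharing_prob_le1 k.+1.
have p0 := sharing_prob_ge0 k; have p0' := sharing_prob_ge0 k.+1.
(* Truncated subtraction only exceeds the real difference, so both inequalities survive the passage
   to [R]. *)
have sub_ge (a b : nat) : (a%:R - b%:R : R) <= (a - b)%:R.
  by rewrite lerBlDr -natrD ler_nat; lia.
have {}upper : sharing_prob k.+1 * k.+1%:R * (2 * (n%:R - (t + k.+1)%:R)) <=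
    sharing_prob k * n%:R.
  rewrite /sharing_prob -!(mulrAC _ _ #|perfect_matching G|%:R^-1).
  rewrite ler_pM2r ?invr_gt0 //.
  apply: (@le_trans _ _ (#|sharing G M k|%:R * n%:R)) => //.
  rewrite -natrM; move: upper; rewrite -(ler_nat R) => /(le_trans _); apply.
  rewrite !natrM ler_wpM2l ?mulr_ge0 // ler_pM2l //; exact: sub_ge.
have {}lower : sharing_prob k * (n%:R - k%:R) <=
    sharing_prob k.+1 * k.+1%:R * (2 * n%:R) + t.+1%:R.
  rewrite /sharing_prob -(mulfK (lt0r_neq0 N_gt0) t.+1%:R).
  rewrite -!(mulrAC _ _ #|perfect_matching G|%:R^-1) -mulrDl.
  rewrite ler_pM2r ?invr_gt0 //.
  move: lower; rewrite -(ler_nat R) natrD !natrM [t.+1%:R * _]mulrC.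
  by apply: le_trans; rewrite ler_wpM2l //; exact: sub_ge.
rewrite ler_pdivlMr // -[n%:R](ger0_norm (ltW nR)) -normrM ler_norml.
move: upper lower p0 p0' p1 p1'; rewrite -(addn1 k) -(addn1 t) !natrD.
move: (sharing_prob k) (sharing_prob (k + 1)%N) => p q.
have k0 : (0 : R) <= k%:R by []. have t0 : (0 : R) <= t%:R by [].
move: n%:R k%:R t%:R nR k0 t0 => x y z x0 y0 z0 upper lower p0 q0 p1 q1.
apply/andP; split.
  have : p * y <= y by rewrite ler_piMl.
  have : 0 <= y * z by rewrite mulr_ge0.
  have : 0 <= y * y by rewrite mulr_ge0.
  move: upper lower; nra.
have : q * ((y + 1) * (z + (y + 1))) <= (y + 1) * (z + (y + 1)).
  by rewrite ler_piMl // mulr_ge0 ?addr_ge0.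
move: upper lower; nra.
Qed.

Lemma sharing_prob_tail K : (0 < n)%N -> (2 * t <= n)%N -> (0 < K)%N ->
  1 - \sum_(k < K) sharing_prob k <= K%:R^-1.
Proof.
move=> n0 tn K0; have KR : (0 : R) < K%:R by rewrite ltr0n.
have := sharing_tail card_T codeg MP K tn n0.
rewrite -(ler_nat R) natrD !natrM natr_sum => h.
rewrite -mulr_suml lerBlDr -(ler_pM2r N_gt0) mul1r mulrDl.
rewrite divfK ?lt0r_neq0 // -(ler_pM2r KR) mulrDl addrC.
by rewrite -[X in _ + X]mulrAC mulVf ?lt0r_neq0 // mul1r.
Qed.

End SharingProbability.

(** * The law of the number of shared edges and its convergence *)

Lemma sharing_law (R : realType) (T : finType) (G : simple_graph T)
    (M : {set {set T}}) (d : measure_display) (Omega : measurableType d)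
    (P : probability Omega R) (X : Omega -> {set {set T}}) k :
  uniformly_distributed P (perfect_matching G) X ->
  P ((fun w => #|(M :&: X w)%SET|) @^-1` [set k]) = (sharing_prob R G M k)%:E.
Proof.
move=> hX; rewrite /sharing_prob.
have -> : (fun w => #|(M :&: X w)%SET|) @^-1` [set k] =
    X @^-1` [set` [pred A : {set {set T}} | #|(M :&: A)%SET| == k]].
  by apply/seteqP; split=> w /=; rewrite inE => /eqP.
rewrite (uniformly_distributed_preimage _ hX); congr (_%:R / _)%:E.
by apply: eq_card => A; rewrite !inE.
Qed.

Theorem theorem1p3 (R : realType)
  (V : nat -> finType) (G : forall n : nat, simple_graph (V n))
  (hV : forall n : nat, #|V n| = (2 * n)%N)
  (t : nat -> R)
  (hdeg : forall n : nat, (min_degree (G n))%:R = (2 * n)%:R - t n)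
  (ht : (fun n : nat => t n / n%:R) @ \oo --> (0 : R))
  (M : forall n : nat, {set {set V n}})
  (hM : forall n : nat, perfect_matching (G n) (M n))
  (d : nat -> measure_display) (Omega : forall n : nat, measurableType (d n))
  (P : forall n : nat, probability (Omega n) R)
  (Rn : forall n : nat, Omega n -> {set {set V n}})
  (hRn : forall n : nat,
    uniformly_distributed (P n) (perfect_matching (G n)) (Rn n)) :
  (fun n : nat =>
     dTV (P n) (fun w : Omega n => Posz #|(M n :&: Rn n w)%SET|)
         (Po (2^-1 : R)) Posz) @ \oo --> (0 : \bar R)%E.
Proof.
pose s n := (2 * n - min_degree (G n))%N.
have codeg n x : (#|[pred y | ~~ G n x y]| <= s n)%N.
  by rewrite /s -hV; exact: codegree_le.
(* This makes the truncated subtraction in [s] exact, so that [s n] equals [t n]. *)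
have min_le n : (min_degree (G n) <= 2 * n)%N.
  rewrite -hV /min_degree; elim: (index_enum _) => [|x r IH].
    by rewrite big_nil.
  by rewrite big_cons; apply: leq_trans IH; exact: geq_minr.
have sE n : (s n)%:R = t n by rewrite natrB // hdeg opprB addrC subrK.
pose p n k := sharing_prob R (G n) (M n) k.
pose q k : R := exp_coeff 2^-1 k * expR (- 2^-1).
have half0 : (0 : R) < 2^-1 by rewrite invr_gt0.
have s_small (e : R) : 0 < e -> \forall n \near \oo, (s n)%:R <= e * n%:R.
  move=> e0; have /cvgr0Pnorm_le/(_ _ e0) := ht.
  apply: filter_app; near=> n => /= h.
  have n0 : (0 : R) < n%:R by rewrite ltr0n; near: n; exact: nbhs_infty_gt.
  by rewrite sE -ler_pdivrMr //; apply: le_trans h; exact: ler_norm.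
have s_half : \forall n \near \oo, (2 * s n + 2 <= n)%N.
  (* With [s n] at most n/4, [2 * s n + 2] is at most n/2 + 2, hence at most n once n is at least
     4. *)
  have e0 : (0 : R) < 4^-1 by rewrite invr_gt0.
  near=> n; rewrite -(ler_nat R) natrD natrM.
  have : (s n)%:R <= 4^-1 * n%:R :> R by near: n; exact: s_small.
  have : 4 <= n%:R :> R by near: n; exact: nbhs_infty_ger.
  lra.
have p_rec k :
    (fun n => k.+1%:R * p n k.+1 - 2^-1 * p n k) @ \oo --> (0 : R).
  apply/cvgr0Pnorm_le => e e0; pose C : R := k.+1%:R.
  have C0 : 0 < C by rewrite ltr0n.
  (* The error is C (s + C) / n: this bound on s / n makes C s / n at most e/2, and n at least 2 C^2
     / e does the same for C^2 / n. *)
  have e1 : 0 < e / (2 * C) by rewrite divr_gt0 // mulr_gt0.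
  near=> n; have n0 : (0 < n)%N by near: n; exact: nbhs_infty_gt.
  have nR : (0 : R) < n%:R by rewrite ltr0n.
  have tn : (2 * s n + 2 <= n)%N by near: n.
  apply: le_trans (sharing_prob_rec R (hV n) (@codeg n) (hM n) k n0 tn) _.
  rewrite ler_pdivrMr // natrD mulrDr -/C.
  have : (s n)%:R <= e / (2 * C) * n%:R by near: n; exact: s_small.
  have : C * C * 2 / e <= n%:R by near: n; exact: nbhs_infty_ger.
  rewrite ler_pdivrMr // -(ler_pM2l C0 (s n)%:R).
  have -> : C * (e / (2 * C) * n%:R) = e * n%:R / 2.
    by field; rewrite lt0r_neq0.
  lra.
have p_tail K : (0 < K)%N ->
    \forall n \near \oo, 1 - \sum_(k < K) p n k <= K%:R^-1.
  move=> K0; near=> n.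
  have n0 : (0 < n)%N by near: n; exact: nbhs_infty_gt.
  have tn : (2 * s n + 2 <= n)%N by near: n.
  apply: (sharing_prob_tail R (hV n) (@codeg n) (hM n) n0 _ K0); lia.
have p_lim k : (p ^~ k) @ \oo --> q k.
  apply: poisson_limit => // n.
  - by move=> j; exact: sharing_prob_ge0.
  - by move=> K; exact: sum_sharing_prob_le1 (hM n) K.
have q_sum : (fun K => \sum_(k < K) q k) @ \oo --> (1 : R).
  have := @cvgMr_tmp _ _ _ _ _ _ (expR (- 2^-1)) (@exp_coeff_sum_cvg R 2^-1).
  rewrite -expRD subrr expR0 => h.
  by under eq_fun do rewrite -mulr_suml; apply: h.
have q_le1 K : \sum_(k < K) q k <= 1.
  rewrite -(cvg_lim _ q_sum) //; apply: nondecreasing_cvgn_le; last first.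
    by apply/cvg_ex; exists 1.
  apply/nondecreasing_seqP => m; rewrite big_ord_recr /= lerDl.
  by rewrite mulr_ge0 ?exp_coeff_ge0 ?expR_ge0 // ltW.
have dTV_bound n K :
    (dTV (P n) (fun w : Omega n => Posz #|(M n :&: Rn n w)%SET|)
      (Po (2^-1 : R)) Posz <=
    (\sum_(k < K) `|p n k - q k| + (1 - \sum_(k < K) q k))%:E)%E.
  apply: (@dTV_le R _ _ (P n) (fun w => #|(M n :&: Rn n w)%SET|)
            _ _ (Po (2^-1 : R)) id) => //.
  - by move=> k; exact: sharing_law.
  - by move=> k; rewrite preimage_id; exact: poisson_prob_set1.
  - exact: sum_sharing_prob_le1 (hM n).
have dTV_ge0 n : (0 <= dTV (P n) (fun w : Omega n =>
    Posz #|(M n :&: Rn n w)%SET|) (Po (2^-1 : R)) Posz)%E.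
  by rewrite mule_ge0 ?lee_fin // esum_ge0.
have dTV_fin n : dTV (P n) (fun w : Omega n =>
    Posz #|(M n :&: Rn n w)%SET|) (Po (2^-1 : R)) Posz \is a fin_num.
  (* At [K = 0] both sums are empty and the bound is 1. *)
  rewrite ge0_fin_numE //; apply: le_lt_trans (dTV_bound n 0%N) _.
  exact: ltry.
apply/fine_cvgP; split; first exact: nearW.
apply/cvgr0Pnorm_le => e e0; have e2 : 0 < e / 2 by rewrite divr_gt0.
(* [K] is fixed before [n]: the Poisson tail beyond [K] takes e/2, and the finitely many pointwise
   errors below [K] take the other half. *)
have /cvgrPdist_le/(_ _ e2)/filter_ex[K KP] := q_sum.
have D0 : (fun n => \sum_(k < K) `|p n k - q k|) @ \oo --> (0 : R).
  elim: (K) => [|m IH].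
    under eq_fun do rewrite big_ord0.
    exact: cvg_cst.
  under eq_fun do rewrite big_ord_recr /=.
  have := cvgD IH (cvg_norm (cvgB (p_lim m) (cvg_cst (q m)))).
  by rewrite subrr normr0 addr0; apply.
have /cvgr0Pnorm_le/(_ _ e2) := D0.
apply: filter_app; near=> n => /= hD.
rewrite ger0_norm ?fine_ge0 // -lee_fin fineK //.
apply: le_trans (dTV_bound n K) _; rewrite lee_fin.
move: KP hD (ler_norm (1 - \sum_(k < K) q k)) (ler_norm (\sum_(k < K) `|p n k - q k|)).
move=> /=; lra.
Unshelve. all: by end_near.
Qed.
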